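(* Let $G_a$ and $G_b$ be strongly connected permutation digraphs on $n$ vertices and of degree $d$, and let $v_0\in V(G_a)$ and $w_0\in V(G_b)$. Then there exists a color-isomorphism of $G_a$ onto $G_b$ mapping $v_0$ onto $w_0$ if and only if $v_0$ and $w_0$ are indistinguishable.
   Context: For a $d$-tuple $a=(a_1,\dots,a_d)$ of permutations of $[n]=\{1,\dots,n\}$, the permutation digraph $G_a$ has vertex set $[n]$ and arcs $(i,a_k)$, $i\in[n]$, $k\in[d]$; the arc $(i,a_k)$ goes from $i$ to $a_k(i)$ and has color $k$; its degree is $d$. $G_a$ is strongly connected if every vertex is reachable from every other by a directed walk (equivalently, $a$ generates a transitive subgroup of $S_n$). A color-isomorphism of $G_a$ onto $G_b$ is a pair of bijections on vertices and on arcs preserving initial vertices, terminal vertices and colors of arcs. Let $\Sigma=\{k^{+1},k^{-1}: k\in[d]\}$. For a word $\kappa$ over $\Sigma$ and a vertex $v$ of $G_a$, $W(\kappa,v)$ is the walk in $G_a$ starting at $v$ which, reading $\kappa$ left to right, at a letter $k^{+1}$ traverses the color-$k$ arc from the current vertex $u$ to $a_k(u)$, and at a letter $k^{-1}$ traverses the color-$k$ arc backwards from $u$ to $a_k^{-1}(u)$; it is closed if it ends at $v$. A word $\kappa$ is a distinguishing word for $v\in V(G_a)$ and $w\in V(G_b)$ if exactly one of $W(\kappa,v)$ in $G_a$ and $W(\kappa,w)$ in $G_b$ is closed; $v$ and $w$ are distinguishable if such a word exists and indistinguishable otherwise. *)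

(* Defs.v *)
From mathcomp Require Import all_boot all_fingroup.

Set Implicit Arguments.
Unset Strict Implicit.
Unset Printing Implicit Defensive.

Record colored_digraph (C : Type) := ColoredDigraph {
  vertices : finType;
  arcs : finType;
  arc_init : arcs -> vertices;
  arc_term : arcs -> vertices;
  arc_color : arcs -> C
}.

Section ColoredDigraph.
Variable C : Type.
Implicit Types G H : colored_digraph C.

Definition adjacent G : rel (vertices G) :=
  [rel u v | [exists e : arcs G, (arc_init e == u) && (arc_term e == v)]].

Definition strongly_connected G : Prop :=
  forall u v : vertices G, connect (@adjacent G) u v.

Definition color_isomorphism G H
    (f : vertices G -> vertices H) (g : arcs G -> arcs H) : Prop :=
  [/\ bijective f, bijective g,
      forall e, arc_init (g e) = f (arc_init e),
      forall e, arc_term (g e) = f (arc_term e)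
    & forall e, arc_color (g e) = arc_color e].

End ColoredDigraph.

Section PermutationDigraph.
Variables n d : nat.
Implicit Type a : d.-tuple 'S_n.

(* The arc (i, a_k) is encoded by the pair (i, k), so that arcs of distinct   *)
(* colors remain distinct even when the tuple has repeated entries.           *)
Definition perm_digraph a : colored_digraph 'I_d :=
  @ColoredDigraph 'I_d 'I_n ('I_n * 'I_d)%type
    (fun e => e.1) (fun e => tnth a e.2 e.1) (fun e => e.2).

(* (k, true) stands for k^{+1} and (k, false) for k^{-1}.                     *)
Definition letter : finType := ('I_d * bool)%type.

Definition word := seq letter.

(* The arc traversed from u when reading l, with the vertex it leads to.      *)
Definition step a (u : vertices (perm_digraph a)) (l : letter) :
    arcs (perm_digraph a) * vertices (perm_digraph a) :=
  let: (k, positive) := l in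
  if positive then
    let e : arcs (perm_digraph a) := (u, k) in (e, arc_term e)
  else
    let e : arcs (perm_digraph a) := ((tnth a k)^-1%g u, k) in (e, arc_init e).

(* A walk from v is recorded as the list of its successive arcs, each paired  *)
(* with the vertex reached by it; v itself is not repeated in the list.       *)
Fixpoint walk a (kappa : word) (v : vertices (perm_digraph a)) :
    seq (arcs (perm_digraph a) * vertices (perm_digraph a)) :=
  if kappa is l :: kappa' then step v l :: walk kappa' (step v l).2 else [::].

Definition closed_walk a (kappa : word) (v : vertices (perm_digraph a)) : bool :=
  last v (unzip2 (walk kappa v)) == v.

End PermutationDigraph.

Section Distinguishability.
Variables (n d : nat) (a b : d.-tuple 'S_n).

Definition distinguishing_word (kappa : word d)
    (v : vertices (perm_digraph a)) (w : vertices (perm_digraph b)) : bool :=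
  closed_walk kappa v (+) closed_walk kappa w.

Definition distinguishable
    (v : vertices (perm_digraph a)) (w : vertices (perm_digraph b)) : Prop :=
  exists kappa : word d, distinguishing_word kappa v w.

Definition indistinguishable
    (v : vertices (perm_digraph a)) (w : vertices (perm_digraph b)) : Prop :=
  ~ distinguishable v w.

End Distinguishability.

(* Main.v *)
Require Import Defs.
From mathcomp Require Import all_boot all_fingroup.

(** Strong connectivity writes every vertex of G_a as the end of a walk
    W(kappa, v0). Walks can be reversed, so W(k1, v0) and W(k2, v0) end at the
    same vertex iff W(k1 k2^-1, v0) is closed; hence, when v0 and w0 are
    indistinguishable, sending the end of W(kappa, v0) to the end of
    W(kappa, w0) is a well-defined injection commuting with each color. *)

Section WalkEnd.
Context {n d : nat} (a : d.-tuple 'S_n).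
Implicit Types (u v : vertices (perm_digraph a)) (l : letter d) (k : word d).

Definition walk_end k v := last v (unzip2 (walk k v)).

Lemma walk_end_cons l k v :
  walk_end (l :: k) v = walk_end k (step v l).2.
Proof. by []. Qed.

Lemma walk_end_cat k1 k2 v :
  walk_end (k1 ++ k2) v = walk_end k2 (walk_end k1 v).
Proof. by elim: k1 v => //= l k1 IH v; rewrite !walk_end_cons IH. Qed.

Definition inv_letter l : letter d := (l.1, ~~ l.2).

Definition inv_word k : word d := rev (map inv_letter k).

Lemma step_inv l v : (step (step v l).2 (inv_letter l)).2 = v.
Proof. by case: l => c [] /=; rewrite ?permK ?permKV. Qed.

Lemma walk_end_inv k v : walk_end (inv_word k) (walk_end k v) = v.
Proof.
elim: k v => // l k IH v.
have -> : inv_word (l :: k) = inv_word k ++ [:: inv_letter l].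
  by rewrite /inv_word map_cons rev_cons cats1.
by rewrite walk_end_cat (walk_end_cons l) IH; apply: step_inv.
Qed.

Lemma walk_end_inj k : injective (walk_end k).
Proof. exact: can_inj (walk_end_inv k). Qed.

Lemma closed_walk_cat_inv k1 k2 v :
  closed_walk (k1 ++ inv_word k2) v = (walk_end k1 v == walk_end k2 v).
Proof.
rewrite /closed_walk -/(walk_end _ _) walk_end_cat.
(* Only the bare [v] is rewritten, as the walk along [k2] and back; the common return walk then
   cancels. *)
by rewrite -{2}(walk_end_inv k2 v) (inj_eq (@walk_end_inj _)).
Qed.

(** A directed path is a walk whose letters are all positive. *)
Lemma walk_end_surj v0 v :
  strongly_connected (perm_digraph a) -> exists k, walk_end k v0 == v.
Proof.
move=> /(_ v0 v) /connectP [p pth ->] {v}.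
elim: p v0 pth => [|u p IH] v0 /=; first by exists [::].
case/andP=> /existsP [[i c] /= /andP [/eqP -> /eqP <-]] /IH [k k_end].
by exists ((c, true) :: k).
Qed.

End WalkEnd.

Section ColorIsomorphism.
Context {n d : nat} {a b : d.-tuple 'S_n}.

(** Initial vertex and color determine an arc, so [g (i, c)] must be [(f i, c)]; its terminal vertex
    gives the equation. *)
Lemma color_isomorphism_perm
    (f : vertices (perm_digraph a) -> vertices (perm_digraph b)) g :
  color_isomorphism f g ->
  forall i c, tnth b c (f i) = f (tnth a c i).
Proof.
case=> _ _ ginit gterm gcol i c.
have := gterm (i, c); have := ginit (i, c); have := gcol (i, c).
by case: (g (i, c)) => j c' /= -> ->.
Qed.

Lemma walk_end_morph
    (f : vertices (perm_digraph a) -> vertices (perm_digraph b)) k v :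
  (forall i c, tnth b c (f i) = f (tnth a c i)) ->
  walk_end b k (f v) = f (walk_end a k v).
Proof.
move=> fM; elim: k v => // -[c s] k IH v.
rewrite !walk_end_cons -IH; congr (walk_end b k _).
case: s => /=; first exact: fM.
(* A backward letter reduces to the forward case after applying [tnth b c] to both sides. *)
by apply: (@perm_inj _ (tnth b c)); rewrite permKV fM permKV.
Qed.

(** Both digraphs have equally many vertices and equally many arcs, so injectivity gives
    bijectivity. *)
Lemma color_isomorphism_of_injective
    (f : vertices (perm_digraph a) -> vertices (perm_digraph b)) :
  injective f -> (forall i c, tnth b c (f i) = f (tnth a c i)) ->
  color_isomorphism f
    ((fun e => (f e.1, e.2)) : arcs (perm_digraph a) -> arcs (perm_digraph b)).
Proof.
move=> f_inj fM; split=> //; first exact: injF_bij.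
  by apply: injF_bij => -[i c] [j c'] [] /f_inj -> ->.
by case=> i c /=; apply: fM.
Qed.

Lemma indistinguishable_closed_walk
    (v : vertices (perm_digraph a)) (w : vertices (perm_digraph b)) :
  indistinguishable v w <-> forall k, closed_walk k v = closed_walk k w.
Proof.
split=> [ind k | eq_cl [k]]; last by rewrite /distinguishing_word eq_cl addbb.
case: (closed_walk k v =P closed_walk k w) => // /eqP neq_cl.
by case: ind; exists k; rewrite /distinguishing_word -negb_eqb.
Qed.

End ColorIsomorphism.

Theorem theorem4 (n d : nat) (a b : d.-tuple 'S_n)
    (conn_a : strongly_connected (perm_digraph a))
    (conn_b : strongly_connected (perm_digraph b))
    (v0 : vertices (perm_digraph a)) (w0 : vertices (perm_digraph b)) :
  (exists (f : vertices (perm_digraph a) -> vertices (perm_digraph b))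
          (g : arcs (perm_digraph a) -> arcs (perm_digraph b)),
      color_isomorphism f g /\ f v0 = w0)
  <-> indistinguishable v0 w0.
Proof.
apply: iff_trans (iff_sym (indistinguishable_closed_walk v0 w0)).
split=> [[f [g [iso_fg <-]]] k | eq_cl].
  have fM := color_isomorphism_perm f g iso_fg.
  have [f_bij _ _ _ _] := iso_fg.
  rewrite /closed_walk -/(walk_end a k v0) -/(walk_end b k (f v0)).
  by rewrite walk_end_morph // (inj_eq (bij_inj f_bij)).
(* Left to right this makes [f] below well defined; right to left it makes [f] injective. *)
have eq_end k1 k2 :
    (walk_end a k1 v0 == walk_end a k2 v0)
    = (walk_end b k1 w0 == walk_end b k2 w0).
  by rewrite -!closed_walk_cat_inv.
have reach v := walk_end_surj a v0 v conn_a.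
(* An arbitrary word reaching [v] is chosen; [fE] shows that the choice is immaterial. *)
pose f v := walk_end b (xchoose (reach v)) w0.
have fE k : f (walk_end a k v0) = walk_end b k w0.
  by apply/eqP; rewrite -eq_end (eqP (xchooseP (reach _))).
exists f; eexists; split; last exact: (fE [::]).
apply: color_isomorphism_of_injective => [u v | i c].
  have [k1 /eqP <-] := reach u; have [k2 /eqP <-] := reach v.
  by move/eqP; rewrite !fE -eq_end => /eqP.
have [k /eqP <-] := reach i.
(* Appending a positive letter of color [c] advances both walks by one arc of that color. *)
by rewrite fE; have := fE (k ++ [:: (c, true)]); rewrite !walk_end_cat => /esym.
Qed.
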